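(* Let $R$ be a pseudo-valuation domain issued from $(V,M,k)$ and set $K := V/M$. Then the following statements are equivalent: (i) For all nonzero ideals $J \subseteq I$ of $R$, $J$ is a $t$-reduction of $I$ if and only if $J$ is a reduction of $I$. (ii) For each $k$-vector subspace $W$ of $K$ containing $k$, there is a positive integer $n$ such that $W^{n}$ is a field.
   Context: All rings are commutative with identity. A domain $R$ is a pseudo-valuation domain issued from $(V,M,k)$ if $V$ is a valuation overring of $R$ (a valuation domain with $R \subseteq V \subseteq$ the quotient field of $R$) with maximal ideal $M$, $k$ is a subfield of $K := V/M$, and $R = \varphi^{-1}(k)$, where $\varphi : V \to K$ is the canonical surjection (so $R$ is local with maximal ideal $M$; the case $R=V$ is allowed). For a $k$-subspace $W$ of $K$, $W^n$ denotes the $k$-subspace of $K$ spanned by all products of $n$ elements of $W$. For a nonzero fractional ideal $I$ of a domain $R$ with quotient field $F$, put $I^{-1} := \{x \in F : xI \subseteq R\}$, $I_v := (I^{-1})^{-1}$, and $I_t := \bigcup J_v$, where $J$ ranges over the nonzero finitely generated $R$-submodules of $I$. For nonzero ideals $J \subseteq I$ of $R$, $J$ is a reduction of $I$ if $JI^{n} = I^{n+1}$ for some positive integer $n$, and $J$ is a $t$-reduction of $I$ if $(JI^{n})_t = (I^{n+1})_t$ for some integer $n \ge 0$. *)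

(* Defs.v *)
From HB Require Import structures.
From mathcomp Require Import all_boot all_order all_algebra.
From mathcomp Require Import generic_quotient ring_quotient.
From mathcomp Require Import boolp classical_sets cardinality.

Set Implicit Arguments.
Unset Strict Implicit.
Unset Printing Implicit Defensive.

Import GRing.Theory.
Local Open Scope classical_set_scope.
Local Open Scope quotient_scope.
Local Open Scope ring_scope.

(* Subsets of a commutative ring A; the scalars R are a subring of A given as
   a set (R and its fractional ideals inside F, or k and its subspaces inside
   K). *)
Section Modules.
Variable A : comNzRingType.
Implicit Types R S N I J : set A.

Definition submodule R N : Prop :=
  [/\ N 0,
      (forall x y, N x -> N y -> N (x + y)) &
      (forall r x, R r -> N x -> N (r * x))].

Definition module_span R S : set A := smallest (submodule R) S.

Definition fin_gen R N : Prop :=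
  exists2 S : set A, finite_set S & N = module_span R S.

Definition module_mul R I J : set A :=
  module_span R [set x * y | x in I & y in J].

(* The only product of zero elements is 1, so module_exp R I 0 is R. *)
Definition module_exp R I (n : nat) : set A :=
  module_span R
    [set \prod_(i < n) f i | f in [set f : 'I_n -> A | forall i, I (f i)]].

Definition nonzero N : Prop := exists2 x, N x & x != 0.

Definition ideal_of R I : Prop := I `<=` R /\ submodule R I.

Definition subfield S : Prop :=
  [/\ S 1,
      (forall x y, S x -> S y -> S (x - y)),
      (forall x y, S x -> S y -> S (x * y)) &
      (forall x, S x -> x != 0 -> exists2 y, S y & x * y = 1)].

End Modules.

Section Closures.
Variable F : fieldType.
Implicit Types R I J : set F.

Definition quotient_field R : Prop :=
  forall x : F, exists a b, [/\ R a, R b, b != 0 & x = a / b].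

Definition frac_inv R I : set F := [set x | forall y, I y -> R (x * y)].

Definition v_closure R I : set F := frac_inv R (frac_inv R I).

Definition t_closure R I : set F :=
  \bigcup_(J in [set J | [/\ fin_gen R J, nonzero J & J `<=` I]]) v_closure R J.

Definition reduction R J I : Prop :=
  exists2 n : nat, (0 < n)%N &
    module_mul R J (module_exp R I n) = module_exp R I n.+1.

Definition t_reduction R J I : Prop :=
  exists n : nat,
    t_closure R (module_mul R J (module_exp R I n)) =
    t_closure R (module_exp R I n.+1).

End Closures.

Section SubringType.
Variables (F : fieldType) (V : subringClosed F).

Definition subring_type : Type := {x : F | x \in V}.

HB.instance Definition _ := SubChoice.on subring_type.
HB.instance Definition _ :=
  [SubChoice_isSubComNzRing of subring_type by <:].

End SubringType.

Section PseudoValuation.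
Variable F : fieldType.

Definition valuation_overring (R : set F) (V : subringClosed F) : Prop :=
  [/\ quotient_field R,
      R `<=` [set x | x \in V] &
      (forall x : F, x != 0 -> x \in V \/ x^-1 \in V)].

(* Elements of idealr are proper ideals. *)
Definition maximal_ideal (B : comNzRingType) (M : idealr B) : Prop :=
  forall I : idealr B, {subset M <= I} -> {subset I <= M}.

Definition pseudo_valuation_domain (R : set F) (V : subringClosed F)
    (M : idealr (subring_type V)) (k : set {ideal_quot M}) : Prop :=
  [/\ valuation_overring R V,
      maximal_ideal M,
      subfield k &
      R = [set val v | v in [set v : subring_type V | k (\pi v)]]].

End PseudoValuation.

(* Main.v *)
(* Call a in I a V-generator of I if I is contained in aV; since V is a valuation
   domain, a finitely generated I has one. For an ideal X of R, X_t is contained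
   in XV, so a t-reduction gives J I^n V = I^(n+1) V. If I has no V-generator,
   then I is an ideal of V and J I^(n+1) = I^(n+2) at once. Otherwise some b in J
   is a V-generator of I, and I = b phi^-1(W) with W a k-subspace containing k:
   as soon as the powers of W are stationary, b I^m = I^(m+1), so J is a
   reduction of I.
   Conversely, for W strictly larger than k and a nonzero in M, aR is always a
   t-reduction of a phi^-1(W), both t-closures being a^2 V. If it is a reduction,
   the powers of W are stationary, hence their stable value L is a ring; applied
   to the subspaces k + k y, this also shows that L is a field. *)
Require Import Defs.
From HB Require Import structures.
From mathcomp Require Import all_boot all_order all_algebra.
From mathcomp Require Import generic_quotient ring_quotient.
From mathcomp Require Import boolp classical_sets cardinality.
Local Open Scope classical_set_scope.

Set Implicit Arguments.
Unset Strict Implicit.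
Unset Printing Implicit Defensive.
Import GRing.Theory.
Local Open Scope quotient_scope.
Local Open Scope ring_scope.

(** * Spans, products and powers of submodules of a commutative ring *)

Section Modules.
Variable A : comNzRingType.
Implicit Types R S N I J P : set A.

Lemma module_span_submodule R S : submodule R (module_span R S).
Proof.
split=> [P [[P0 _ _] _] //|x y Sx Sy P PS|r x Rr Sx P PS].
- by case: (PS) => -[_ PD _] _; apply: PD; [apply: Sx|apply: Sy].
- by case: (PS) => -[_ _ PZ] _; apply: PZ => //; apply: Sx.
Qed.

Lemma sub_module_span R S : S `<=` module_span R S.
Proof. exact: sub_gen_smallest. Qed.

Lemma module_span_le R S P :
  submodule R P -> S `<=` P -> module_span R S `<=` P.
Proof. exact: smallest_sub. Qed.

(** Lets a claim about products be checked on generators of one factor while the other factor [c]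
    stays fixed. *)
Lemma submodule_mul_preimage R P c :
  submodule R P -> submodule R [set x | P (c * x)].
Proof.
case=> P0 PD PZ; split=> [|x y Px Py|r x Rr Px] /=.
- by rewrite mulr0.
- by rewrite mulrDr; apply: PD.
- by rewrite mulrCA; apply: PZ.
Qed.

Lemma submodule_exp R I n : submodule R (module_exp R I n).
Proof. exact: module_span_submodule. Qed.

Lemma mem_module_mul R I J x y : I x -> J y -> module_mul R I J (x * y).
Proof. by move=> Ix Jy; apply: sub_module_span; exists x => //; exists y. Qed.

Lemma module_mul_le R I J P : submodule R P ->
  (forall x y, I x -> J y -> P (x * y)) -> module_mul R I J `<=` P.
Proof.
by move=> PR IJP; apply: module_span_le => // _ [x Ix [y Jy] <-]; apply: IJP.
Qed.

Lemma module_exp0 R I : R 1 -> submodule R R -> module_exp R I 0 = R.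
Proof.
move=> R1 RR; have [_ _ RM] := RR; apply/seteqP; split.
  by apply: module_span_le => // _ [f _ <-]; rewrite big_ord0.
move=> r Rr; rewrite -[r]mulr1.
have [_ _ +] := module_span_submodule R
  [set \prod_(i < 0) f i | f in [set f : 'I_0 -> A | forall i, I (f i)]].
apply=> //; apply: sub_module_span; exists (fun=> 1); last by rewrite big_ord0.
by case.
Qed.

Lemma module_expS R I n :
  module_exp R I n.+1 = module_mul R I (module_exp R I n).
Proof.
apply/seteqP; split.
  apply: module_span_le (module_span_submodule _ _) _ => _ [f If <-].
  rewrite big_ord_recl; apply: mem_module_mul => //; apply: sub_module_span.
  by exists (fun i => f (lift ord0 i)) => // i; apply: If.
apply: module_mul_le (submodule_exp _ _ _) _ => x y Ix; move: y.
apply: (module_span_le (submodule_mul_preimage x (submodule_exp R I n.+1))).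
move=> _ [f If <-]; apply: sub_module_span.
exists (fun i => if unlift ord0 i is Some j then f j else x) => [i|].
  by case: unliftP.
by rewrite big_ord_recl unlift_none; under eq_bigr do rewrite liftK.
Qed.

Lemma mem_module_expS R I n x y :
  I x -> module_exp R I n y -> module_exp R I n.+1 (x * y).
Proof. by rewrite module_expS; apply: mem_module_mul. Qed.

Lemma mem_module_expD R I m n x y : module_exp R I m x -> module_exp R I n y ->
  module_exp R I (m + n) (x * y).
Proof.
move=> xIm yIn; rewrite mulrC; move: x xIm.
have PR k := submodule_mul_preimage y (submodule_exp R I k).
elim: m => [|m IHm].
  by apply: (module_span_le (PR _)) => _ [f _ <-] /=; rewrite big_ord0 mulr1.
rewrite module_expS; apply: (module_mul_le (PR _)) => x z Ix /IHm /= yz.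
by rewrite mulrCA addSn; apply: mem_module_expS.
Qed.

Lemma mem_module_expX R I n x : I x -> module_exp R I n (x ^+ n).
Proof.
move=> Ix; apply: sub_module_span; exists (fun=> x) => //.
by rewrite prodr_const card_ord.
Qed.

Lemma module_exp1 R I : R 1 -> submodule R R -> submodule R I ->
  module_exp R I 1 = I.
Proof.
move=> R1 RR IR; have [_ _ IM] := IR; rewrite module_expS module_exp0 //.
apply/seteqP; split.
  by apply: module_mul_le => // x y Ix Ry; rewrite mulrC; apply: IM.
by move=> x Ix; rewrite -[x]mulr1; apply: mem_module_mul.
Qed.

Lemma module_exp_leS R I n : I 1 -> module_exp R I n `<=` module_exp R I n.+1.
Proof. by move=> I1 x xI; rewrite -[x]mul1r; apply: mem_module_expS. Qed.

Lemma module_exp_stable R I n m : module_exp R I n.+1 = module_exp R I n ->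
  module_exp R I (m + n) = module_exp R I n.
Proof.
by move=> E; elim: m => // m IHm; rewrite addSn module_expS IHm -module_expS.
Qed.

Lemma module_mul_subl R I J N :
  J `<=` I -> module_mul R J N `<=` module_mul R I N.
Proof.
move=> JI; apply: module_mul_le (module_span_submodule _ _) _ => x y Jx Ny.
by apply: mem_module_mul => //; apply: JI.
Qed.

Definition dilate (a : A) S : set A := [set a * x | x in S].

Lemma submodule_dilate R a S : submodule R S -> submodule R (dilate a S).
Proof.
case=> S0 SD SM; split=> [|_ _ [x Sx <-] [y Sy <-]|r _ Rr [x Sx <-]].
- by exists 0 => //; rewrite mulr0.
- by exists (x + y); [apply: SD|rewrite mulrDr].
- by exists (r * x); [apply: SM|rewrite mulrCA].
Qed.

Lemma module_exp_dilate R a I n :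
  module_exp R (dilate a I) n = dilate (a ^+ n) (module_exp R I n).
Proof.
apply/seteqP; split.
  apply: module_span_le (submodule_dilate _ (submodule_exp _ _ _)) _.
  elim: n => [|n IHn] _ [f If <-].
    rewrite big_ord0; exists 1; last by rewrite mulr1.
    by apply: sub_module_span; exists (fun=> 1); [case|rewrite big_ord0].
  rewrite big_ord_recl; have [x Ix <-] := If ord0.
  have [|y yI <-] := IHn (\prod_i f (lift ord0 i)).
    by eexists; [|reflexivity] => i; apply: If.
  by exists (x * y); [apply: mem_module_expS|rewrite exprS mulrACA].
move=> _ [x xI <-]; move: x xI.
apply: (module_span_le (submodule_mul_preimage _ (submodule_exp _ _ _))).
move=> _ [f If <-]; apply: sub_module_span.
exists (fun i => a * f i) => [i|]; first by exists (f i).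
by rewrite big_split prodr_const card_ord.
Qed.

End Modules.

(** * The maximal ideal of [V], seen inside [F], and the residue field *)

Section PseudoValuationDomain.
Variables (F : fieldType) (R : set F) (V : subringClosed F).
Variables (M : idealr (subring_type V)) (k : set {ideal_quot M}).
Hypothesis pvdR : pseudo_valuation_domain R k.

Local Notation B := (subring_type V).
Local Notation phi := (\pi_{ideal_quot M}).

Let valV (x : F) : x != 0 -> x \in V \/ x^-1 \in V.
Proof. by case: pvdR => -[_ _ +] _ _ _; apply. Qed.

(** The maximal ideal of [V] as a subset of [F]. Zero is listed apart because its formal inverse is
    0, which lies in [V]; membership in [V] need not be required, since [V] is a valuation ring. *)
Definition nonunit : {pred F} := [pred x | (x == 0) || (x^-1 \notin V)].

Lemma nonunitM (x v : F) : v \in V -> x \in nonunit -> v * x \in nonunit.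
Proof.
rewrite !inE; have [-> _|v0] := eqVneq v 0; first by rewrite mul0r eqxx.
have [->|x0 /=] := eqVneq x 0; first by rewrite mulr0 eqxx.
move=> vV; apply: contraNT; rewrite negb_or negbK => /andP[_ vxV].
by rewrite -(mulKf v0 x) invfM invrK mulrC rpredM // mulrC.
Qed.

Lemma nonunitD (x y : F) :
  x \in nonunit -> y \in nonunit -> x + y \in nonunit.
Proof.
(* Whichever of x/y and y/x lies in [V], the sum is a [V]-multiple of the denominator, which is a
   nonunit. *)
have wlog_div x' y' : y' != 0 -> x' / y' \in V -> y' \in nonunit ->
    x' + y' \in nonunit.
  move=> y0 xyV yM; have -> : x' + y' = (x' / y' + 1) * y'.
    by rewrite mulrDl mul1r mulfVK.
  by apply: nonunitM => //; rewrite rpredD ?rpred1.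
have [->|x0] := eqVneq x 0; first by rewrite add0r.
have [->|y0] := eqVneq y 0; first by rewrite addr0.
have xy0 : x / y != 0 by rewrite mulf_neq0 ?invr_eq0.
move=> xM yM; have [|yxV] := valV xy0; first by move=> /wlog_div; apply.
by rewrite addrC; apply: wlog_div => //; rewrite -invf_div.
Qed.

(** The nonunits form a proper ideal, and it contains [M] because a unit in [M] would put 1 there;
    maximality of [M] gives the other inclusion. *)
Lemma mem_maximal (v : B) : (v \in M) = (val v \in nonunit).
Proof.
have closedN : idealr_closed [pred u : B | val u \in nonunit].
  split=> [||a u w uN wN].
  - by rewrite !inE rmorph0 eqxx.
  - by rewrite !inE rmorph1 oner_eq0 invr1 rpred1.
  - rewrite inE rmorphD rmorphM; apply: nonunitD => //.
    by apply: nonunitM => //; apply: valP.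
pose N : idealr B := HB.pack (fun u : B => val u \in nonunit)
  (isIdealr.Build B _ closedN).
have MN : {subset M <= N}.
  move=> u uM; rewrite -topredE /= inE; apply/negPn; rewrite negb_or negbK.
  apply/negP => /andP[u0 uV]; suff : 1 \in M by rewrite idealr1.
  have -> : 1 = (Sub (val u)^-1 uV : B) * u.
    by apply: val_inj; rewrite rmorph1 rmorphM /= mulVf.
  by rewrite idealMr.
by apply/idP/idP => [/MN|]; [|case: pvdR => _ /(_ N MN) + _ _; apply].
Qed.


Let subV : set F := [set x | x \in V].

Lemma nonunit_sub (x : F) : x \in nonunit -> x \in V.
Proof.
rewrite inE; have [->|x0 /= xV] := eqVneq x 0; first by rewrite rpred0.
by have [|] := valV x0 => //; rewrite (negPf xV).
Qed.

Lemma unit_nonzero (x : F) : x \notin nonunit -> x != 0 /\ x^-1 \in V.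
Proof. by rewrite inE negb_or negbK => /andP[]. Qed.

Lemma residue_eq0 (v : B) : (phi v == 0) = (val v \in nonunit).
Proof. by rewrite -mem_maximal -[v in RHS]subr0 Quotient.idealrBE rmorph0. Qed.

Lemma residue_eq (u v : B) : (phi u == phi v) = (val u - val v \in nonunit).
Proof. by rewrite -subr_eq0 -rmorphB residue_eq0 rmorphB. Qed.

Lemma residue_surj (w : {ideal_quot M}) : exists v : B, phi v = w.
Proof. by exists (repr w); rewrite reprK. Qed.

Lemma residue_inv (w : {ideal_quot M}) : w != 0 -> exists y, w * y = 1.
Proof.
have [v <-] := residue_surj w.
rewrite residue_eq0 => /unit_nonzero[v0 vV].
exists (phi (Sub (val v)^-1 vV)); rewrite -rmorphM.
have -> : v * Sub (val v)^-1 vV = 1; last by rewrite rmorph1.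
by apply: val_inj; rewrite rmorph1 rmorphM /= divff.
Qed.

Lemma subfield_one : k 1.
Proof. by case: pvdR => _ _ []. Qed.

Lemma subfield_submodule : submodule k k.
Proof.
case: pvdR => _ _ [k1 kB kM _] _.
have k0 : k 0 by rewrite -(subrr 1); apply: (kB).
split=> // x y kx ky; rewrite -[y]opprK -[- y]sub0r; apply: (kB) => //.
exact: kB.
Qed.

(** * Preimages in [V] of subspaces of the residue field *)

Definition lift (W : set {ideal_quot M}) : set F :=
  [set val v | v in [set v : B | W (phi v)]].

Lemma liftE W (v : B) : lift W (val v) = W (phi v).
Proof. by apply/propext; split=> [[u Wu /val_inj <-] //|]; exists v. Qed.

Let val_zero : val (0 : B) = 0 := rmorph0 _.
Let val_one : val (1 : B) = 1 := rmorph1 _.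
Let val_add (u v : B) : val (u + v) = val u + val v := rmorphD _ u v.
Let val_mul (u v : B) : val (u * v) = val u * val v := rmorphM _ u v.

Lemma lift_inj : injective lift.
Proof.
move=> W W' WW'; apply/seteqP; split=> w; have [v <-] := residue_surj w.
  by rewrite -liftE WW' liftE.
by rewrite -liftE -WW' liftE.
Qed.

Lemma pvd_lift : R = lift k.
Proof. by case: pvdR. Qed.

Lemma lift_subV W : lift W `<=` subV.
Proof. by move=> _ [v _ <-]; apply: valP. Qed.

Lemma nonunit_lift W (x : F) : W 0 -> x \in nonunit -> lift W x.
Proof.
move=> W0 xM; have xV := nonunit_sub xM.
rewrite -[x]/(val (Sub x xV : B)) liftE.
by have /eqP-> : phi (Sub x xV) == 0 by rewrite residue_eq0.
Qed.

Lemma submodule_lift W : submodule k W -> submodule R (lift W).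
Proof.
case=> W0 WD WM; rewrite pvd_lift; split=> [|_ _ [u Wu <-] [v Wv <-]|_ _ [r kr <-] [v Wv <-]].
- by rewrite -val_zero liftE rmorph0.
- by rewrite -val_add liftE rmorphD; apply: WD.
- by rewrite -val_mul liftE rmorphM; apply: WM.
Qed.

Lemma R_one : R 1.
Proof. by rewrite pvd_lift -val_one liftE rmorph1; apply: subfield_one. Qed.

Lemma R_submodule : submodule R R.
Proof.
rewrite [X in submodule _ X]pvd_lift.
exact/submodule_lift/subfield_submodule.
Qed.

Lemma nonunit_R (x : F) : x \in nonunit -> R x.
Proof. by rewrite pvd_lift; apply: nonunit_lift; case: subfield_submodule. Qed.

Lemma R_subV : R `<=` subV.
Proof. by rewrite pvd_lift; apply: lift_subV. Qed.

Lemma submodule_subV : submodule R subV.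
Proof.
rewrite /subV; split=> [|x y|r x /R_subV] /=; [exact: rpred0|exact: rpredD|exact: rpredM].
Qed.

(** The inclusion from right to left rests on [lift W] containing 1: its powers then contain the
    whole kernel of [phi], so that membership of an element of [V] in such a power depends only on
    its residue. *)
Lemma module_exp_lift W n : submodule k W -> k `<=` W ->
  module_exp R (lift W) n = lift (module_exp k W n).
Proof.
move=> Wk kW; apply/seteqP; split.
  apply: module_span_le (submodule_lift (submodule_exp _ _ _)) _.
  move=> _ [f Wf <-].
  have fV i : f i \in V by apply: lift_subV (Wf i).
  have -> : \prod_(i < n) f i = val (\prod_(i < n) (Sub (f i) (fV i) : B)).
    by rewrite rmorph_prod.
  rewrite liftE rmorph_prod; apply: sub_module_span.
  by exists (fun i => phi (Sub (f i) (fV i))) => // i; rewrite -liftE; apply: Wf.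
have [E0 ED EM] := submodule_exp R (lift W) n.
have W1 : lift W 1.
  by rewrite -val_one liftE rmorph1; apply/kW/subfield_one.
have nonunit_exp x : x \in nonunit -> module_exp R (lift W) n x.
  move=> xM; rewrite -[x]mulr1; apply: EM; first exact: nonunit_R.
  by rewrite -(expr1n _ n); apply: mem_module_expX.
have lift_eq (u v : B) : phi u = phi v ->
    module_exp R (lift W) n (val u) -> module_exp R (lift W) n (val v).
  move=> uv uE; rewrite -[val v](subrK (val u)); apply: ED => //.
  by apply: nonunit_exp; rewrite -residue_eq uv.
(* Quantifying over all representatives of a residue makes the right-hand side a [k]-subspace, so
   the inclusion can be tested on products. *)
suff WE : module_exp k W n `<=`
    [set w | forall v : B, phi v = w -> module_exp R (lift W) n (val v)].
  by move=> _ [v Wv <-]; apply: WE Wv v erefl.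
apply: module_span_le.
  split=> [v v0|x y xE yE v|r x kr xE v] /=.
  - by apply: nonunit_exp; rewrite -residue_eq0 v0.
  - have [u ux] := residue_surj x; have [u' uy] := residue_surj y.
    rewrite -ux -uy -rmorphD => vxy; apply: (lift_eq (u + u')); first by rewrite vxy.
    by rewrite val_add; apply: ED; [apply: xE|apply: yE].
  - have [u ux] := residue_surj x; have [s sr] := residue_surj r.
    rewrite -ux -sr -rmorphM => vrx; apply: (lift_eq (s * u)); first by rewrite vrx.
    by rewrite val_mul; apply: EM; [rewrite pvd_lift liftE sr|apply: xE].
move=> _ [f Wf <-] v vf.
apply: (lift_eq (\prod_i repr (f i))).
  by rewrite rmorph_prod vf; apply: eq_bigr => i _; rewrite /= reprK.
rewrite rmorph_prod; apply: sub_module_span.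
by exists (fun i => val (repr (f i))) => // i; rewrite liftE reprK.
Qed.

(** * Divisibility with respect to [V], and bounds on v- and t-closures *)

Lemma divisibility_total (x y : F) : dilate x subV y \/ dilate y subV x.
Proof.
have [->|x0] := eqVneq x 0.
  by right; exists 0; rewrite ?mulr0 // /subV /= rpred0.
have [->|y0] := eqVneq y 0.
  by left; exists 0; rewrite ?mulr0 // /subV /= rpred0.
have xy0 : x / y != 0 by rewrite mulf_neq0 ?invr_eq0.
have [xyV|] := valV xy0; [right|rewrite invf_div => yxV; left].
  by exists (x / y); rewrite // mulrC divfK.
by exists (y / x); rewrite // mulrC divfK.
Qed.

Lemma dilate_trans (a x y : F) :
  dilate a subV x -> dilate x subV y -> dilate a subV y.
Proof.
by move=> [u uV <-] [v vV <-]; exists (u * v); rewrite ?mulrA //; apply: rpredM.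
Qed.

Lemma dilate_refl (a : F) : dilate a subV a.
Proof. by exists 1; rewrite ?mulr1 //; apply: rpred1. Qed.

Lemma not_dilate (a x : F) : ~ dilate x subV a -> x / a \in nonunit.
Proof.
move=> xa; rewrite inE; apply/negPn; rewrite negb_or negbK.
apply/negP => /andP[xa0 axV]; apply: xa; exists (x / a)^-1 => //.
by rewrite invf_div mulrC divfK //; apply: contraNneq xa0 => ->; rewrite mul0r.
Qed.

(** Divisibility being total, one of finitely many generators divides all the others; 0 serves for
    the empty list. *)
Lemma fin_gen_dilate J : fin_gen R J -> exists2 a, J a & J `<=` dilate a subV.
Proof.
case=> S /finite_seqP[s ->] JE.
have JR : submodule R J by rewrite JE; apply: module_span_submodule.
have sJ : [set` s] `<=` J by rewrite JE; apply: sub_module_span.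
have [a Ja sa] : exists2 a, J a & [set` s] `<=` dilate a subV.
  elim: s {JE} sJ => [|y s IHs] sJ; first by exists 0; [case: JR|].
  have [x xs|a Ja sa] := IHs; first by apply: sJ; rewrite /= in_cons xs orbT.
  have [ya|ay] := divisibility_total y a.
    exists y; first by apply: sJ; rewrite /= mem_head.
    move=> x; rewrite /= in_cons => /predU1P[->|/sa]; first exact: dilate_refl.
    exact: dilate_trans.
  by exists a => // x; rewrite /= in_cons => /predU1P[-> //|/sa].
exists a => //; rewrite JE; apply: module_span_le => //.
exact: submodule_dilate submodule_subV.
Qed.

(* If x / a is outside V, then V a / x lies in the maximal ideal, hence
   V / x is contained in R : J; this forces V = R. *)
Lemma v_closure_le_dilate J a : a != 0 ->
  J `<=` dilate a subV -> v_closure R J `<=` dilate a subV.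
Proof.
move=> a0 Ja x Jx; have [//|ax] := pselect (dilate a subV x).
have x0 : x != 0.
  by apply: contra_notN ax => /eqP->; exists 0; rewrite ?mulr0 //; apply: rpred0.
have VR : subV `<=` R.
  move=> v vV; rewrite -[v](mulVKf x0); apply: Jx => z /Ja[u uV <-].
  have -> : x^-1 * v * (a * u) = v * u * (a / x).
    by rewrite mulrACA mulrC [_ * a]mulrC.
  by apply/nonunit_R/nonunitM; [apply: rpredM|apply: not_dilate].
exists (a^-1 * x); last by rewrite mulVKf.
apply/R_subV; rewrite mulrC; apply: Jx => _ /Ja[u uV <-].
by rewrite mulKf //; apply: VR.
Qed.

(** A finitely generated [J] inside [X] has a [V]-generator, and the multiples of that generator
    also contain the v-closure of [J]. *)
Lemma t_closure_le X : submodule R X ->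
  t_closure R X `<=` [set x | exists2 y, X y & dilate y subV x].
Proof.
move=> XR x [J [/fin_gen_dilate[a Ja Ja'] [y Jy y0] JX]] Jx.
exists a; first exact: JX.
apply: v_closure_le_dilate Jx => //; apply: contraNneq y0 => a0.
by have [u _ <-] := Ja' _ Jy; rewrite a0 mul0r.
Qed.

Lemma sub_t_closure X : submodule R X -> nonzero X -> X `<=` t_closure R X.
Proof.
(* The nonzero element [z] is added because [x] may be 0, while the t-closure only uses nonzero
   submodules. *)
move=> XR [z Xz z0] x Xx; exists (module_span R [set x; z]); last first.
  by move=> y yJ; rewrite mulrC; apply: yJ; apply: sub_module_span; left.
split.
- by exists [set x; z] => //; apply: finite_set2.
- by exists z => //; apply: sub_module_span; right.
- by apply: module_span_le => // _ [] ->.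
Qed.

Lemma t_closure_mono X Y : X `<=` Y -> t_closure R X `<=` t_closure R Y.
Proof. by move=> XY x [J [Jfg Jnz JX]] Jx; exists J => //; split=> // y /JX /XY. Qed.

Lemma module_exp_le_dilate I a n :
  I `<=` dilate a subV -> module_exp R I n `<=` dilate (a ^+ n) subV.
Proof.
move=> Ia; elim: n => [|n IHn].
  rewrite module_exp0; [|exact: R_one|exact: R_submodule].
  by move=> x /R_subV xV; exists x; rewrite // mul1r.
rewrite module_expS.
apply: module_mul_le (submodule_dilate _ submodule_subV) _.
move=> _ _ /Ia[u uV <-] /IHn[v vV <-]; exists (u * v); first exact: rpredM.
by rewrite exprS mulrACA.
Qed.

(** Used by contraposition: when [phi v] is outside [k], every [s] in [R] with [s * val v] in [R]
    must be a nonunit. *)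
Lemma subfield_residue (s : F) (v : B) :
  R s -> s \notin nonunit -> R (s * val v) -> k (phi v).
Proof.
rewrite pvd_lift => -[u ku <-] uM; rewrite -val_mul liftE rmorphM => kuv.
have [_ _ [_ _ kM kV] _] := pvdR.
have [|y ky uy] := kV _ ku; first by rewrite residue_eq0.
have -> : phi v = y * (phi u * phi v) by rewrite mulrA [y * _]mulrC uy mul1r.
exact: kM.
Qed.

Lemma reduction_t_reduction I J : reduction R J I -> t_reduction R J I.
Proof. by case=> n _ E; exists n; rewrite E. Qed.

(** * From t-reductions to reductions *)

Section Reductions.
Variables (I J : set F).
Hypotheses (IR : ideal_of R I) (nzI : nonzero I) (JI : J `<=` I).

Lemma reduction_of_le n : (0 < n)%N ->
  module_exp R I n.+1 `<=` module_mul R J (module_exp R I n) ->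
  reduction R J I.
Proof.
move=> n0 IJ; exists n => //; apply/seteqP; split=> //.
by rewrite module_expS; apply: module_mul_subl.
Qed.

Lemma t_reduction_le : t_reduction R J I ->
  exists n, module_exp R I n.+1 `<=`
    [set x | exists2 y, module_mul R J (module_exp R I n) y & dilate y subV x].
Proof.
case=> n E; exists n => x xI.
suff : t_closure R (module_mul R J (module_exp R I n)) x.
  exact: t_closure_le (module_span_submodule _ _) _.
rewrite E; apply: sub_t_closure xI; first exact: submodule_exp.
case: nzI => z Iz z0; exists (z ^+ n.+1); first exact: mem_module_expX.
exact: expf_neq0.
Qed.

(* Without a generator of I V in I, the ideal I is already a V-module. *)
Lemma t_reduction_no_generator : (forall a, I a -> ~ I `<=` dilate a subV) ->
  t_reduction R J I -> reduction R J I.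
Proof.
move=> noa /t_reduction_le[n In]; have [_ [_ _ IM]] := IR.
have IV a v : I a -> v \in V -> I (a * v).
  move=> Ia vV.
  (* An element [b] of [I] outside aV makes a/b a nonunit, so that v(a/b) lies in [R] and multiplies
     [b] to av. *)
  have /existsNP[b /not_implyP[Ib ab]] := noa a Ia.
  have b0 : b != 0.
    by apply: contra_notN ab => /eqP->; exists 0; rewrite ?mulr0 //; apply: rpred0.
  have -> : a * v = v * (a / b) * b by rewrite -mulrA divfK // mulrC.
  by apply: IM => //; apply/nonunit_R/nonunitM/not_dilate.
(* The exponent is raised by one: this makes it positive, and the extra factor from [I] absorbs the
   coefficient in [V]. *)
apply: (@reduction_of_le n.+1) => //.
rewrite module_expS; apply: module_mul_le (module_span_submodule _ _) _.
move=> x _ Ix /In[z zJ [v vV <-]].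
have -> : x * (z * v) = x * v * z by rewrite -mulrA [v * z]mulrC.
move: z zJ.
apply: (module_mul_le (submodule_mul_preimage _ (module_span_submodule _ _))).
move=> j w Jj wI; rewrite /= mulrCA; apply: mem_module_mul => //.
by apply: mem_module_expS => //; apply: IV.
Qed.

(* If no element of J generated a V, then a^(n+1) would lie in a^(n+1) M V. *)
Lemma t_reduction_common_generator a : I a -> I `<=` dilate a subV ->
  t_reduction R J I -> exists2 b, J b & dilate b subV a.
Proof.
move=> Ia IaV /t_reduction_le[n In].
apply: contrapT => nob.
have a0 : a != 0.
  by case: nzI => z /IaV[u _ <-]; apply: contraNneq => ->; rewrite mul0r.
have nonunitR : submodule R [set x | x \in nonunit].
  split=> [|x y|r x /R_subV rV] /=; first by rewrite inE eqxx.
    exact: nonunitD.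
  exact: nonunitM.
have JIn : module_mul R J (module_exp R I n) `<=`
    dilate (a ^+ n.+1) [set x | x \in nonunit].
  apply: module_mul_le (submodule_dilate _ nonunitR) _ => b w Jb.
  move=> /(module_exp_le_dilate IaV)[u uV <-].
  exists (u * (b / a)).
    by apply/nonunitM => //; apply: not_dilate => ba; apply: nob; exists b.
  by rewrite exprS mulrC -(mulrA u) (mulrA (b / a)) divfK // mulrCA [u * _]mulrC.
(* Cancelling a^(n+1) leaves mv = 1 with [m] a nonunit, which is absurd. *)
have [_ /JIn[m mM <-] [v vV]] := In _ (mem_module_expX Ia).
rewrite -mulrA -[RHS]mulr1 => /(mulfI (expf_neq0 _ a0)) mv.
by have := nonunitM vV mM; rewrite mulrC mv inE oner_eq0 invr1 rpred1.
Qed.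

(** The module I/b lies between [R] and [V], hence contains the kernel of [phi] and is the preimage
    of its image [W]. Once W^m is a field containing [W], W^(m+1) lies in W^m, and scaling back by
    b^(m+1) puts I^(m+1) inside b I^m. *)
Lemma t_reduction_generator b : J b -> I `<=` dilate b subV ->
  (forall W : set {ideal_quot M}, submodule k W -> k `<=` W ->
     exists2 n : nat, (0 < n)%N & subfield (module_exp k W n)) ->
  reduction R J I.
Proof.
move=> Jb IbV powW; have [_ [I0 ID IM]] := IR; have Ib := JI Jb.
pose W := [set phi v | v in [set v : B | I (b * val v)]].
have WE (v : B) : W (phi v) = I (b * val v).
  apply/propext; split=> [[u Iu uv]|Iv]; last by exists v.
  rewrite -[val v](subrK (val u)) mulrDr; apply: (ID) => //.
  by rewrite mulrC; apply: IM => //; apply: nonunit_R; rewrite -residue_eq uv.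
have Wk : submodule k W.
  split=> [|x y|r x].
  - by rewrite -(rmorph0 phi) WE val_zero mulr0.
  - have [u <-] := residue_surj x; have [v <-] := residue_surj y.
    by rewrite -rmorphD !WE val_add mulrDr; apply: ID.
  - have [u <-] := residue_surj x; have [s <-] := residue_surj r.
    move=> ks; rewrite -rmorphM !WE val_mul mulrCA => Iu; apply: IM => //.
    by rewrite pvd_lift liftE.
have kW : k `<=` W.
  move=> r; have [s <-] := residue_surj r => ks; rewrite WE mulrC.
  by apply: IM => //; rewrite pvd_lift liftE.
have IE : I = dilate b (lift W).
  apply/seteqP; split=> [x Ix|_ [_ [v Wv <-] <-]]; last by rewrite -WE.
  have [u uV ux] := IbV x Ix; exists u => //.
  by rewrite -[u]/(val (Sub u uV : B)) liftE WE /= ux.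
have [m m0 [W1 _ WM _]] := powW W Wk kW.
have Wm : module_exp k W m.+1 `<=` module_exp k W m.
  rewrite module_expS; apply: module_mul_le (submodule_exp _ _ _) _ => x y Wx.
  (* Positivity of [m] matters here: [x] is padded with m - 1 factors 1 to land in W^m. *)
  apply: (WM); rewrite -(prednK m0) -[x]mulr1 -(expr1n _ m.-1).
  apply: mem_module_expS => //; apply: mem_module_expX; apply: kW.
  exact: subfield_one.
apply: (reduction_of_le m0).
rewrite [X in module_exp _ X _.+1]IE module_exp_dilate module_exp_lift //.
move=> _ [_ [v /Wm Wv <-] <-]; rewrite exprS -mulrA; apply: mem_module_mul => //.
rewrite IE module_exp_dilate module_exp_lift //.
by exists (val v) => //; exists v.
Qed.

End Reductions.

Lemma t_reduction_reduction I J :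
  (forall W : set {ideal_quot M}, submodule k W -> k `<=` W ->
     exists2 n : nat, (0 < n)%N & subfield (module_exp k W n)) ->
  ideal_of R I -> nonzero I -> J `<=` I ->
  t_reduction R J I -> reduction R J I.
Proof.
move=> powW IR nzI JI tJI.
have [[a Ia IaV]|noa] := pselect (exists2 a, I a & I `<=` dilate a subV).
  have [b Jb ba] := t_reduction_common_generator nzI Ia IaV tJI.
  by apply: (t_reduction_generator IR JI Jb) => // x /IaV; apply: dilate_trans.
by apply: t_reduction_no_generator => // a Ia IaV; apply: noa; exists a.
Qed.

(** * From reductions to stationary powers and fields *)

Lemma t_reduction_dilate (W : set {ideal_quot M}) (a : F) (v : B) :
  submodule k W -> k `<=` W -> W (phi v) -> ~ k (phi v) -> a != 0 ->
  t_reduction R (dilate a R) (dilate a (lift W)).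
Proof.
move=> Wk kW Wv kv a0; exists 1%N.
have R1 := R_one; have RR := R_submodule.
have RW : R `<=` lift W by rewrite pvd_lift => _ [u /kW Wu <-]; exists u.
apply/seteqP; split.
  rewrite [in X in _ `<=` X]module_expS; apply: t_closure_mono.
  apply: module_mul_subl.
  by move=> _ [r /RW Wr <-]; exists r.
have IaV : dilate a (lift W) `<=` dilate a subV.
  by move=> _ [x /lift_subV xV <-]; exists x.
move=> x /(t_closure_le (submodule_exp _ _ _))[y /(module_exp_le_dilate IaV) ya2 yx].
have [u uV <-] := dilate_trans ya2 yx => {x y ya2 yx}.
rewrite module_exp1 //; last exact/submodule_dilate/submodule_lift.
have Ja : dilate a R a by exists 1; rewrite ?mulr1.
(* These two elements of J I already have v-closure containing a^2 V: if [y] sends both into [R],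
   then y a^2 is a nonunit because [phi v] is outside [k], so u y a^2 lies in [R] for every [u] in
   [V]. *)
exists (module_span R [set a ^+ 2; a ^+ 2 * val v]).
  split.
  - by exists [set a ^+ 2; a ^+ 2 * val v] => //; apply: finite_set2.
  - by exists (a ^+ 2); [apply: sub_module_span; left|apply: expf_neq0].
  - apply: module_span_le (module_span_submodule _ _) _ => _ [] ->.
      by apply: mem_module_mul => //; case: Ja => r /RW Wr ra; exists r.
    by rewrite -mulrA; apply: mem_module_mul => //; exists (val v); rewrite ?liftE.
move=> y yJ; have Ry := yJ _ (sub_module_span (or_introl erefl)).
have Ryv := yJ _ (sub_module_span (or_intror erefl)).
have -> : a ^+ 2 * u * y = u * (y * a ^+ 2) by rewrite mulrAC mulrC [y * _]mulrC.
apply/nonunit_R/nonunitM => //; apply: contrapT => /negP yM; apply: kv.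
by apply: subfield_residue Ry yM _; rewrite -mulrA.
Qed.

(** When [W] exceeds [k], the hypothesis is applied to aR inside a [lift W] for a nonzero nonunit
    [a]; dividing the resulting equality by a^(n+1) shows that the powers of [lift W], hence those
    of [W], stabilise. *)
Lemma stable_power (W : set {ideal_quot M}) :
  (forall I J : set F,
     ideal_of R I -> ideal_of R J -> nonzero I -> nonzero J -> J `<=` I ->
     t_reduction R J I -> reduction R J I) ->
  submodule k W -> k `<=` W ->
  exists2 n, (0 < n)%N & module_exp k W n.+1 = module_exp k W n.
Proof.
move=> redR Wk kW; have W1 := kW _ subfield_one.
have [Wsub|] := pselect (W `<=` k).
  exists 1%N => //; have -> : W = k by apply/seteqP.
  apply/seteqP; split; last by apply: module_exp_leS; exact: subfield_one.
  have kk := subfield_submodule; have [_ _ kM] := kk.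
  rewrite module_expS module_exp1 //; last exact: subfield_one.
  exact: module_mul_le.
move=> /existsNP[w /not_implyP[+ +]]; have [v <-] := residue_surj w => Wv kv.
(* The denominator of [val v] supplies the nonzero nonunit: were it a unit of [V], the residue of
   [val v] would lie in [k]. *)
have [[QF _ _] _ _ _] := pvdR; have [r [a [Rr Ra a0 vE]]] := QF (val v).
have aM : a \in nonunit.
  apply: contrapT => /negP aM; apply/kv/(subfield_residue Ra aM).
  by rewrite vE mulrC divfK.
have WR := submodule_lift Wk.
have RW : R `<=` lift W by rewrite pvd_lift => _ [u /kW Wu <-]; exists u.
have dilateR S : S `<=` subV -> submodule R S -> ideal_of R (dilate a S).
  move=> SV SR; split; last exact: submodule_dilate.
  by move=> _ [x /SV xV <-]; rewrite mulrC; apply/nonunit_R/nonunitM.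
have nzd S : S 1 -> nonzero (dilate a S).
  by move=> S1; exists a => //; exists 1; rewrite ?mulr1.
have [||||||n n0 E] := redR (dilate a (lift W)) (dilate a R).
- by apply: dilateR => //; apply: lift_subV.
- by apply: dilateR R_submodule; apply: R_subV.
- by apply/nzd/RW/R_one.
- by apply/nzd/R_one.
- by move=> _ [x /RW Wx <-]; exists x.
- exact: t_reduction_dilate kv a0.
exists n => //; apply/lift_inj; rewrite -!module_exp_lift //.
apply/seteqP; split; last by apply: module_exp_leS; apply/RW/R_one.
move=> t tW.
have : module_exp R (dilate a (lift W)) n.+1 (a ^+ n.+1 * t).
  by rewrite module_exp_dilate; exists t.
rewrite -E => tJ.
suff /(_ _ tJ)[t' t'W /(mulfI (expf_neq0 _ a0)) <- //] :
  module_mul R (dilate a R) (module_exp R (dilate a (lift W)) n) `<=`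
    dilate (a ^+ n.+1) (module_exp R (lift W) n).
have PR := submodule_exp R (lift W) n; have [_ _ PM] := PR.
apply: module_mul_le (submodule_dilate _ PR) _ => _ y [s Rs <-].
rewrite module_exp_dilate => -[z zP <-]; exists (s * z); first exact: PM.
by rewrite exprS mulrACA.
Qed.

(* A stable power L is a ring; for x in L the stability of the powers of
   k + k x^-1 expresses x^-1 as a polynomial in x over k. *)
Lemma subfield_stable_power (W : set {ideal_quot M}) :
  (forall W' : set {ideal_quot M}, submodule k W' -> k `<=` W' ->
    exists2 n, (0 < n)%N & module_exp k W' n.+1 = module_exp k W' n) ->
  submodule k W -> k `<=` W ->
  exists2 n, (0 < n)%N & subfield (module_exp k W n).
Proof.
move=> powW Wk kW; have [n n0 E] := powW W Wk kW.
have [k0 kD kM] := subfield_submodule; have k1 := subfield_one.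
exists n => //; set L := module_exp k W n.
have LR : submodule k L := submodule_exp _ _ _.
have [L0 LD LZ] := LR.
have L1 : L 1 by rewrite -(expr1n _ n); apply: mem_module_expX; apply: kW.
have LM x y : L x -> L y -> L (x * y).
  by move=> Lx Ly; rewrite /L -(module_exp_stable n E); apply: mem_module_expD.
have LX x i : L x -> L (x ^+ i).
  by move=> Lx; elim: i => // i IHi; rewrite exprS; apply: LM.
have kN x : k x -> k (- x).
  by move=> kx; have [_ _ [_ kB _ _] _] := pvdR; rewrite -sub0r; apply: kB.
split=> [//|x y Lx Ly|//|x Lx x0].
  by apply: LD => //; rewrite -mulN1r; apply: LZ => //; apply: kN.
have [y xy] := residue_inv x0; exists y => //.
pose W' := [set z | exists c d, [/\ k c, k d & z = c + d * y]].
have W'k : submodule k W'.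
  split=> [|_ _ [c [d [kc kd ->]]] [c' [d' [kc' kd' ->]]]|r _ kr [c [d [kc kd ->]]]].
  - by exists 0, 0; rewrite mul0r addr0.
  - exists (c + c'), (d + d'); rewrite mulrDl addrACA.
    by split=> //; apply: kD.
  - by exists (r * c), (r * d); rewrite mulrDr mulrA; split=> //; apply: kM.
have kW' : k `<=` W' by move=> c kc; exists c, 0; rewrite mul0r addr0.
have W'y : W' y by exists 0, 1; rewrite mul1r add0r.
have [m _ Em] := powW W' W'k kW'.
(* One factor [x] goes to each of the [m] factors c + dy, turning it into cx + d, which lies in the
   ring [L]. *)
have W'L : module_exp k W' m `<=` [set z | L (x ^+ m * z)].
  apply: module_span_le (submodule_mul_preimage _ LR) _ => _ [f Wf <-] /=.
  have -> : x ^+ m * \prod_i f i = \prod_(i < m) (x * f i).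
    by rewrite big_split prodr_const card_ord.
  apply: big_ind => // i _; have [c [d [kc kd ->]]] := Wf i.
  rewrite mulrDr mulrCA xy mulr1; apply: LD.
    by rewrite mulrC; apply: LZ.
  by rewrite -[d]mulr1; apply: LZ.
(* By stability y^(m+1) lies in the m-th power of [W'], so the m factors [x] suffice to bring it
   into [L]. *)
suff -> : y = x ^+ m * y ^+ m.+1.
  by apply: W'L; rewrite -Em; apply: mem_module_expX.
by rewrite exprSr mulrA -exprMn xy expr1n mul1r.
Qed.

End PseudoValuationDomain.

Theorem theorem2p2 (F : fieldType) (R : set F) (V : subringClosed F)
    (M : idealr (subring_type V)) (k : set {ideal_quot M})
    (pvdR : pseudo_valuation_domain R k) :
  (forall I J : set F,
     ideal_of R I -> ideal_of R J -> nonzero I -> nonzero J -> J `<=` I ->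
     (t_reduction R J I <-> reduction R J I))
  <->
  (forall W : set {ideal_quot M},
     submodule k W -> k `<=` W ->
     exists2 n : nat, (0 < n)%N & subfield (module_exp k W n)).
Proof.
split=> [redR W Wk kW|powW I J IR JR nzI nzJ JI].
  apply: (subfield_stable_power pvdR) => // W' W'k kW'.
  apply: (stable_power pvdR) => // I J IR JR nzI nzJ JI.
  by rewrite redR.
split; last exact: reduction_t_reduction.
exact: (t_reduction_reduction pvdR).
Qed.
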